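(* Let $F\subseteq\mathbb{R}^n$, $f\colon\mathbb{R}^n\to\mathbb{R}$, let $(\mathcal{C},\mathcal{D},g,z,\mathcal{T},\epsilon)$ be an $(F,f)$-valid configuration with $\mathcal{T}=(V,E,B,\sigma)$, and let $\mathcal{C}'\subseteq\mathcal{C}$ and $\mathcal{D}'\subseteq\mathcal{D}$. Then $(\mathcal{C}',\mathcal{D}',g,z,\mathcal{T},\epsilon)$ is also $(F,f)$-valid if at least one of the following holds: (a) $\mathcal{C}'=\mathcal{C}$; or (b) $\mathcal{C}'=\mathcal{C}\setminus\{C\}$ for some $C\supseteq\bigcap\mathcal{C}'$; or (c) $\mathcal{C}'=\mathcal{C}\setminus\{C\}$ for some $C\subseteq\mathbb{R}^n$, $\sigma_v=(\,)$ is the empty list for all $v\in V$, and $C$ is derivable from $(\mathcal{C}',\emptyset,g,z,\mathcal{T},\epsilon)$ by redundance-based strengthening.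
   Context: Constraints are arbitrary subsets of $\mathbb{R}^n$. For $\mathcal{C}\subseteq\mathcal{P}(\mathbb{R}^n)$ (power set) write $\bigcap\mathcal{C}=\bigcap_{C\in\mathcal{C}}C$, with $\bigcap\emptyset=\mathbb{R}^n$. For a list $\tau=(i_1,\dots,i_k)\in\{\pm1,\dots,\pm n\}^k$ write $\tau(x)=(\mathrm{sgn}(i_1)x_{|i_1|},\dots,\mathrm{sgn}(i_k)x_{|i_k|})\in\mathbb{R}^k$ for $x\in\mathbb{R}^n$ and $\tau(C)=\{\tau(x):x\in C\}$ for $C\subseteq\mathbb{R}^n$; the empty list is allowed. For another list $\tau'=(i'_1,\dots,i'_{k'})$, write $\tau\trianglelefteq\tau'$ if $k\le k'$ and $i_j=i'_j$ for all $1\le j\le k$. For a node $v$ of a directed graph, $\delta^+(v)$ is its set of children. Branching tree: a tuple $\mathcal{T}=(V,E,B,\sigma)$ is a $\mathcal{C}$-consistent branching tree if: (T1) $(V,E)$ is an arborescence with $1\le|V|<\infty$ and root $r\in V$. (T2) Each $v\in V$ has a branching constraint $B_v\subseteq\mathbb{R}^n$, and $B_r=\mathbb{R}^n$. (T3) For all $u\in V$ with $\delta^+(u)\ne\emptyset$: $\bigcap\mathcal{C}\subseteq\bigcup_{v\in\delta^+(u)}B_v$. (T4) Each $v\in V$ has a list $\sigma_v\in\{\pm1,\dots,\pm n\}^{\ell_v}$, $\ell_v\in\{0,\dots,n\}$, with $|(\sigma_v)_1|,\dots,|(\sigma_v)_{\ell_v}|$ pairwise distinct. (T5) $\sigma_u\trianglelefteq\sigma_v$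 for all $u\in V$, $v\in\delta^+(u)$. (T6) For all $v\in V$ and $1\le i\le\ell_v$: $\max\{\sigma_v(x)_i:x\in\bigcap\mathcal{C}\}<\infty$ (i.e. the set is bounded above). (T7) For all $u\in V$ and $v\ne w$ in $\delta^+(u)$: $\sigma_u(B_v)\cap\sigma_u(B_w)=\emptyset$. Relations: for a $\mathcal{C}$-consistent $\mathcal{T}$ and $v\in V$ let $\mathcal{B}_v=\{B_u: u \text{ is a node on the } r\text{-}v\text{-path in } \mathcal{T}\}$. For $x,y\in\bigcap\mathcal{C}$ let $\mathrm{dcn}(x,y)$ be the deepest node $w\in V$ with $x,y\in\bigcap(\mathcal{C}\cup\mathcal{B}_w)$. For $\epsilon>0$ and $a,b\in\mathbb{R}^k$, let $a\succ_\epsilon b$ mean $a\neq b$ and $a_i\ge b_i+\epsilon$ for the smallest index $i$ with $a_i\ne b_i$. For $x,y\in\bigcap\mathcal{C}$ and $v=\mathrm{dcn}(x,y)$: $x\succeq_{\epsilon,\mathcal{T}}y$ iff $\sigma_v(x)=\sigma_v(y)$ or $\sigma_v(x)\succ_\epsilon\sigma_v(y)$; $x\succ_{\epsilon,\mathcal{T}}y$ iff $\sigma_v(x)\succ_\epsilon\sigma_v(y)$. Configuration: let $F\subseteq\mathbb{R}^n$, $f\colon\mathbb{R}^n\to\mathbb{R}$. A configuration $(\mathcal{C},\mathcal{D},g,z,\mathcal{T},\epsilon)$ with $\mathcal{C},\mathcal{D}\subseteq\mathcal{P}(\mathbb{R}^n)$, $g\colon\mathbb{R}^n\to\mathbb{R}$,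 $z\in\mathbb{R}\cup\{\infty\}$, $\mathcal{T}$ a branching tree and $\epsilon$ a real number is $(F,f)$-valid if: (V1) $\mathcal{T}$ is $\mathcal{C}$-consistent and $\epsilon>0$. (V2) If $z<\infty$, there exists $x\in F$ with $f(x)\le z$. (V3) For all real $\hat z<z$, there exists $x\in F$ with $f(x)\le\hat z$ if and only if there exists $x\in\bigcap\mathcal{C}$ with $g(x)\le\hat z$. (V4) For every $x\in\bigcap\mathcal{C}$ with $g(x)<z$ there exists $y\in\bigcap(\mathcal{C}\cup\mathcal{D})$ with $y\succeq_{\epsilon,\mathcal{T}}x$ and $g(y)\le g(x)$. Redundance-based strengthening: a constraint $C\subseteq\mathbb{R}^n$ is derivable from $(\mathcal{C},\mathcal{D},g,z,\mathcal{T},\epsilon)$, where $\mathcal{T}$ is $\mathcal{C}$-consistent and $\epsilon>0$, by redundance-based strengthening if there exists $\omega\colon\mathbb{R}^n\to\mathbb{R}^n$ such that for all $x\in\bigcap(\mathcal{C}\cup\mathcal{D})$ with $x\notin C$ we have $\omega(x)\in\bigcap(\mathcal{C}\cup\mathcal{D}\cup\{C\})$, $\omega(x)\succeq_{\epsilon,\mathcal{T}}x$ and $g(\omega(x))\le g(x)$. *)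

(* Defs.v *)
From mathcomp Require Import all_boot all_order all_algebra.
From mathcomp Require Import all_classical all_reals ereal.

Set Implicit Arguments.
Unset Strict Implicit.
Unset Printing Implicit Defensive.

Import Order.TTheory GRing.Theory Num.Theory.
Local Open Scope classical_set_scope.
Local Open Scope ring_scope.

Notation constraint R n := (set 'rV[R]_n).

Definition sols (R : realType) (n : nat) (CC : set (constraint R n)) :
    constraint R n :=
  \bigcap_(C in CC) C.

(* The element of {-1, +1, ..., -n, +n} with absolute value [i + 1] is encoded
   as [(b, i)] with [i : 'I_n]; [b = true] marks the negative sign. *)
Definition sindex (n : nat) : Type := (bool * 'I_n)%type.

Definition sproj (R : realType) (n : nat) (tau : seq (sindex n))
    (x : 'rV[R]_n) : 'rV[R]_(size tau) :=
  \row_(j < size tau)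
    let s := tnth (in_tuple tau) j in (-1) ^+ s.1 * x ord0 s.2.

Record branching_tree (R : realType) (n : nat) := BranchingTree {
  node : finType;
  edge : rel node;
  root : node;
  branch : node -> constraint R n;
  sigma : node -> seq (sindex n)
}.

(* A walk [r :: p] of the digraph is given by its tail [p]. *)
Definition walk (V : finType) (e : rel V) (r v : V) (p : seq V) : Prop :=
  path e r p /\ last r p = v.

Definition arborescence (V : finType) (e : rel V) (r : V) : Prop :=
  forall v, exists! p, walk e r v p.

Definition children (R : realType) (n : nat) (T : branching_tree R n)
    (u : node T) : set (node T) :=
  [set v | edge u v].

Definition consistent (R : realType) (n : nat) (CC : set (constraint R n))
    (T : branching_tree R n) : Prop :=
  [/\ arborescence (@edge R n T) (root T),
      branch (root T) = setT,
      (forall u : node T, children u !=set0 ->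
         sols CC `<=` \bigcup_(v in children u) branch v),
      (forall v : node T,
         (size (sigma v) <= n)%N /\ uniq [seq s.2 | s <- sigma v]) &
   [/\ (forall u v : node T, children u v -> prefix (sigma u) (sigma v)),
       (forall (v : node T) (i : 'I_(size (sigma v))),
          has_ubound [set sproj (sigma v) x ord0 i | x in sols CC]) &
       (forall u v w : node T, children u v -> children u w -> v <> w ->
          (sproj (sigma u) @` branch v) `&` (sproj (sigma u) @` branch w)
            = set0)]].

(* The nodes on the path from the root to [v]; [xget] selects the walk, which
   is unique when the digraph is an arborescence. *)
Definition root_path (R : realType) (n : nat) (T : branching_tree R n)
    (v : node T) : seq (node T) :=
  root T :: xget [::] (walk (@edge R n T) (root T) v).

Definition depth (R : realType) (n : nat) (T : branching_tree R n)
    (v : node T) : nat :=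
  (size (root_path v)).-1.

Definition path_branches (R : realType) (n : nat) (T : branching_tree R n)
    (v : node T) : set (constraint R n) :=
  [set branch u | u in [set u | u \in root_path v]].

(* For a consistent tree and [x], [y] in [sols CC], the root satisfies the
   condition and the maximiser is unique. *)
Definition dcn (R : realType) (n : nat) (CC : set (constraint R n))
    (T : branching_tree R n) (x y : 'rV[R]_n) : node T :=
  [arg max_(w > root T | `[< sols (CC `|` path_branches w) x /\
                             sols (CC `|` path_branches w) y >]) depth w]%N.

Definition lex_gt (R : realType) (k : nat) (eps : R) (a b : 'rV[R]_k) : Prop :=
  exists i : 'I_k,
    [/\ (forall j : 'I_k, (j < i)%N -> a ord0 j = b ord0 j),
        a ord0 i <> b ord0 i & b ord0 i + eps <= a ord0 i].

Definition tree_ge (R : realType) (n : nat) (CC : set (constraint R n))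
    (T : branching_tree R n) (eps : R) (x y : 'rV[R]_n) : Prop :=
  let v := dcn CC T x y in
  sproj (sigma v) x = sproj (sigma v) y \/
  lex_gt eps (sproj (sigma v) x) (sproj (sigma v) y).

Record configuration (R : realType) (n : nat) := Config {
  core : set (constraint R n);
  derived : set (constraint R n);
  objective : 'rV[R]_n -> R;
  bound : \bar R;
  bound_neq_ninfty : bound != -oo%E;
  tree : branching_tree R n;
  epsilon : R
}.
Arguments Config {R n} core derived objective bound bound_neq_ninfty tree epsilon.

Definition valid (R : realType) (n : nat) (F : constraint R n)
    (f : 'rV[R]_n -> R) (K : configuration R n) : Prop :=
  let: Config CC DD g z _ T eps := K in
  [/\ consistent CC T /\ 0 < eps,
      ((z < +oo)%E -> exists2 x, F x & ((f x)%:E <= z)%E),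
      (forall zh : R, (zh%:E < z)%E ->
         (exists2 x, F x & f x <= zh) <->
         (exists2 x, sols CC x & g x <= zh)) &
      (forall x, sols CC x -> ((g x)%:E < z)%E ->
         exists y, [/\ sols (CC `|` DD) y, tree_ge CC T eps y x & g y <= g x])].

Definition redundance_derivable (R : realType) (n : nat)
    (K : configuration R n) (C : constraint R n) : Prop :=
  let: Config CC DD g z _ T eps := K in
  [/\ consistent CC T, 0 < eps &
      exists omega : 'rV[R]_n -> 'rV[R]_n,
        forall x, sols (CC `|` DD) x -> ~ C x ->
          [/\ sols (CC `|` DD `|` [set C]) (omega x),
              tree_ge CC T eps (omega x) x & g (omega x) <= g x]].

(* Main.v *)
Require Import Defs.
From mathcomp Require Import all_boot all_order all_algebra.
From mathcomp Require Import all_classical all_reals ereal.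

Set Implicit Arguments.
Unset Strict Implicit.
Unset Printing Implicit Defensive.

Import Order.TTheory GRing.Theory Num.Theory.
Local Open Scope classical_set_scope.
Local Open Scope ring_scope.

(** Weakening a configuration endangers two of the validity conditions: that the
    core has solutions below exactly the same objective bounds as the original
    problem, and that each core solution is dominated by one satisfying the
    derived constraints too.  Both, like the tree conditions, the deepest common
    node and hence the order [tree_ge], depend on the core [CC] only through
    [sols CC].

    - If [CC'] and [CC] have the same solutions, as when nothing is deleted or
      the deleted constraint is implied by the rest, every condition carries
      over; a smaller set of derived constraints only makes domination easier
      ([valid_same_sols]).
    - If the deleted constraint is redundant, the solution set may grow, but
      the witness map sends each new solution to an old one with no larger
      objective ([redundance_repair]).  This preserves the attainable bounds,
      and a point dominating the repaired point serves for the original one.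
      That last step compares the two in the order given by [CC'], where in
      general neither transitivity nor agreement with the order given by [CC]
      is available; but when all lists [sigma] are empty, [tree_ge] relates all
      points ([tree_ge_sigma_nil]). *)

Lemma solsU (R : realType) (n : nat) (CC DD : set (constraint R n)) :
  sols (CC `|` DD) = sols CC `&` sols DD.
Proof. exact: bigcap_setU. Qed.

Lemma sols_anti (R : realType) (n : nat) (CC DD : set (constraint R n)) :
  CC `<=` DD -> sols DD `<=` sols CC.
Proof. by move=> sub x xDD C /sub; apply: xDD. Qed.

(** Only an inclusion, since [C] need not belong to [CC]. *)
Lemma sols_setD1 (R : realType) (n : nat) (CC : set (constraint R n))
    (C : constraint R n) :
  sols (CC `\ C) `&` C `<=` sols CC.
Proof.
move=> x [xCC' xC] D CCD.
by have [->//|DC] := pselect (D = C); apply: xCC'.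
Qed.

Lemma consistent_same_sols (R : realType) (n : nat)
    (CC CC' : set (constraint R n)) (T : branching_tree R n) :
  sols CC' = sols CC -> consistent CC T -> consistent CC' T.
Proof. by rewrite /consistent => ->. Qed.

Lemma tree_ge_same_sols (R : realType) (n : nat)
    (CC CC' : set (constraint R n)) (T : branching_tree R n) (eps : R) :
  sols CC' = sols CC -> tree_ge CC' T eps = tree_ge CC T eps.
Proof.
move=> eqs; rewrite /tree_ge.
suff -> : dcn CC' T = dcn CC T by [].
apply/funext => x; apply/funext => y; rewrite /dcn.
by congr extremum; apply/funext => w /=; rewrite !solsU eqs.
Qed.

(** Vectors of length zero are equal, so the first alternative in the definition
    of [tree_ge] always holds. *)
Lemma tree_ge_sigma_nil (R : realType) (n : nat)
    (CC : set (constraint R n)) (T : branching_tree R n) (eps : R)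
    (x y : 'rV[R]_n) :
  (forall v : node T, sigma v = [::]) -> tree_ge CC T eps x y.
Proof.
by move=> nil; left; rewrite nil; apply/rowP => -[].
Qed.

Lemma valid_same_sols (R : realType) (n : nat)
    (F : constraint R n) (f : 'rV[R]_n -> R)
    (CC DD CC' DD' : set (constraint R n)) (g : 'rV[R]_n -> R)
    (z : \bar R) (hz : z != -oo%E) (T : branching_tree R n) (eps : R) :
  sols CC' = sols CC -> DD' `<=` DD ->
  valid F f (Config CC DD g z hz T eps) ->
  valid F f (Config CC' DD' g z hz T eps).
Proof.
move=> eqs subD [[cons eps0] V2 V3 V4]; split=> //.
- by split=> //; apply: consistent_same_sols cons.
- by rewrite eqs.
- rewrite eqs (tree_ge_same_sols _ _ eqs) => x xCC gx.
  have [y [yCD yx gy]] := V4 x xCC gx.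
  exists y; split=> //; move: yCD; rewrite !solsU eqs => -[yC yD].
  by split=> //; apply: sols_anti yD.
Qed.

(** The witness map is only specified on the points violating [C]; a point
    satisfying [C] already solves [CC] and is its own repair. *)
Lemma redundance_repair (R : realType) (n : nat)
    (CC : set (constraint R n)) (g : 'rV[R]_n -> R)
    (z : \bar R) (hz : z != -oo%E) (T : branching_tree R n) (eps : R)
    (C : constraint R n) :
  redundance_derivable (Config (CC `\ C) set0 g z hz T eps) C ->
  forall x, sols (CC `\ C) x -> exists2 y, sols CC y & g y <= g x.
Proof.
move=> [_ _ [omega omegaP]] x xCC'.
have [xC|nxC] := pselect (C x).
  by exists x => //; apply: (@sols_setD1 _ _ _ C).
have xsol : sols (CC `\ C `|` set0) x by rewrite setU0.
have [wsol _ gw] := omegaP x xsol nxC.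
exists (omega x) => //; apply: (@sols_setD1 _ _ _ C).
by move: wsol; rewrite setU0 solsU {2}/sols bigcap_set1.
Qed.

Theorem theorem10 (R : realType) (n : nat)
    (F : constraint R n) (f : 'rV[R]_n -> R)
    (CC DD : set (constraint R n)) (g : 'rV[R]_n -> R)
    (z : \bar R) (hz : z != -oo%E) (T : branching_tree R n) (eps : R)
    (CC' DD' : set (constraint R n)) :
  valid F f (Config CC DD g z hz T eps) ->
  CC' `<=` CC -> DD' `<=` DD ->
  [\/ CC' = CC,
      (exists2 C : constraint R n, CC' = CC `\ C & sols CC' `<=` C) |
      (exists C : constraint R n,
         [/\ CC' = CC `\ C,
             (forall v : node T, sigma v = [::]) &
             redundance_derivable (Config CC' set0 g z hz T eps) C])] ->
  valid F f (Config CC' DD' g z hz T eps).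
Proof.
move=> val subC subD.
move=> [eqC|[C eqC impl]|[C [eqC nil red]]].
- by apply: valid_same_sols val => //; rewrite eqC.
- apply: valid_same_sols val => //; apply/seteqP.
  split=> [x xCC'|]; last exact: sols_anti.
  apply: (@sols_setD1 _ _ _ C).
  by split; [rewrite -eqC | apply: impl].
- have [cons eps0 _] := red; subst CC'.
  have repair := redundance_repair red.
  have [_ V2 V3 V4] := val; split=> //.
  + move=> zh zhz; rewrite V3 //; split=> -[x xsol gx].
      by exists x => //; apply: sols_anti xsol.
    by have [y ysol gy] := repair x xsol; exists y => //; apply: le_trans gx.
  + move=> x xsol gxz; have [w wsol gw] := repair x xsol.
    have gwz : ((g w)%:E < z)%E by apply: le_lt_trans gxz; rewrite lee_fin.
    have [y [ysol _ gy]] := V4 w wsol gwz.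
    exists y; split; [|exact: tree_ge_sigma_nil|exact: le_trans gw].
    by apply: sols_anti ysol; apply: setUSS.
Qed.
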